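(* Let $M$ be a matroid that is not OTE. Then there exist (i) a non-modular pair $(F,H)$ of flats of $M$, where $H$ is a hyperplane of $M$, and (ii) an extension $N$ of $M$ such that $(\operatorname{cl}_N(F),\operatorname{cl}_N(H))$ is a modular pair in $N$.
   Context: A pair $(X,Y)$ of flats is modular if $\operatorname{rk}(X)+\operatorname{rk}(Y)=\operatorname{rk}(X\cup Y)+\operatorname{rk}(X\cap Y)$. A modular cut of $M$ is a set $\mathcal{M}$ of flats closed under taking flat supersets and such that $F_1\cap F_2\in\mathcal{M}$ whenever $F_1,F_2\in\mathcal{M}$ form a modular pair; it is principal if it equals $\{G\text{ flat}: G\supseteq F\}$ for some flat $F$. $M$ is OTE if every nonempty modular cut is principal. An extension of $M$ on $E$ is a matroid $N$ on $F\supseteq E$ with $N|E=M$. *)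

(* Defs.v *)
From mathcomp Require Import all_boot finmap.
From mathcomp Require Import mathcomp_extra boolp classical_sets functions cardinality.

Set Implicit Arguments.
Unset Strict Implicit.
Unset Printing Implicit Defensive.

Local Open Scope classical_set_scope.
Local Open Scope nat_scope.

(* Matroids of finite rank on an arbitrary, possibly infinite, ground set,
   which is the whole type E. When E is finite, rk_finitary holds trivially and
   the remaining fields are the usual rank axioms. On an infinite E it cannot be
   dropped: it excludes the function that is 0 on finite and 1 on infinite sets. *)
Record matroid (E : choiceType) := Matroid {
  rk :> set E -> nat ;
  rk_le_card : forall A : {fset E}, rk [set` A] <= #|` A| ;
  rk_mono : forall X Y : set E, X `<=` Y -> rk X <= rk Y ;
  rk_submod : forall X Y : set E,
    rk (X `|` Y) + rk (X `&` Y) <= rk X + rk Y ;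
  rk_finitary : forall X : set E,
    exists Y : set E, [/\ finite_set Y, Y `<=` X & rk Y = rk X]
}.

Section MatroidDefs.
Variables (E : choiceType) (M : matroid E).

Definition cl (X : set E) : set E := [set e | rk M (e |` X) = rk M X].

Definition is_flat (X : set E) : Prop := cl X = X.

Definition is_hyperplane (H : set E) : Prop :=
  is_flat H /\ (rk M H).+1 = rk M [set: E].

Definition modular_pair (X Y : set E) : Prop :=
  rk M X + rk M Y = rk M (X `|` Y) + rk M (X `&` Y).

Definition is_modular_cut (C : set (set E)) : Prop :=
  [/\ forall F, C F -> is_flat F,
      forall F G, C F -> is_flat G -> F `<=` G -> C G
    & forall F G, C F -> C G -> modular_pair F G -> C (F `&` G)].

Definition is_principal (C : set (set E)) : Prop :=
  exists2 F, is_flat F & C = [set G | is_flat G /\ F `<=` G].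

Definition OTE : Prop :=
  forall C : set (set E), is_modular_cut C -> C !=set0 -> is_principal C.

End MatroidDefs.

(* N is an extension of M, the ground set E of M being identified with its image
   under the injection i; the rank condition says that N|E = M. *)
Definition is_extension (E E' : choiceType) (M : matroid E) (N : matroid E')
    (i : E -> E') : Prop :=
  injective i /\ forall X : set E, rk N (i @` X) = rk M X.

(* Main.v *)
(* Let C be a non-principal modular cut. Restrict C to the flats containing L,
   where L has maximal rank among the flats for which this restriction is still
   non-principal. Every e outside L then lies in a smallest member of C, so two
   members of C meet in a member of C or in L. Take F in C of minimal rank m and a
   hyperplane H in C not containing F, so that F and H meet in L. A single
   extension by C need not make (F, H) modular; instead add a whole set P of
   m - 1 - rk L points at once, all of them to every member of C, by
     rk (X + Q) = min (rk X + |Q|, least rank of a member of C containing X).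
   In this extension F and H meet in L + P, which has rank m - 1. *)

Require Import Defs.
From mathcomp Require Import all_boot finmap.
From mathcomp Require Import mathcomp_extra boolp classical_sets functions cardinality.
From mathcomp Require Import zify.

Local Open Scope classical_set_scope.

Lemma setU1_absorb {T : Type} (e : T) (X : set T) : X e -> e |` X = X.
Proof. by move=> Xe; apply/seteqP; split=> [x [->|]|x Xx] //; right. Qed.

Lemma exists_max_bounded {T : Type} (P : T -> Prop) (f : T -> nat) (b : nat) :
  (exists x, P x) -> (forall x, P x -> (f x <= b)%N) ->
  exists2 x, P x & forall y, P y -> (f y <= f x)%N.
Proof.
move=> [x0 Px0] fb.
pose Q n := `[< exists2 x, P x & f x = n >].
have exQ : exists n, Q n by exists (f x0); apply/asboolP; exists x0.
have Qb n : Q n -> (n <= b)%N by move=> /asboolP [x Px <-]; exact: fb.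
case: (ex_maxnP exQ Qb) => n /asboolP [x Px fx] nmax.
by exists x => // y Py; rewrite fx; apply: nmax; apply/asboolP; exists y.
Qed.

(** * Closure, flats and hyperplanes *)

Section Flats.
Set Implicit Arguments.
Unset Strict Implicit.
Variables (E : choiceType) (M : matroid E).
Implicit Types (X Y F G : set E) (e : E).

Lemma rk0 : M set0 = 0%N.
Proof. by have := rk_le_card M fset0; rewrite set_fset0 cardfs0 leqn0 => /eqP. Qed.

Lemma rkU1 X e : (M (e |` X) <= (M X).+1)%N.
Proof.
have e1 : (M [set e] <= 1)%N.
  by rewrite -set_fset1; apply: leq_trans (rk_le_card M _) _; rewrite cardfs1.
by have := rk_submod M [set e] X; lia.
Qed.

Lemma rkU1_mono X Y e : X `<=` Y -> M (e |` X) = M X -> M (e |` Y) = M Y.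
Proof.
move=> XY eX; have := rk_submod M (e |` X) Y.
rewrite -setUA (proj2 (setUidPr _ _) XY) eX.
have : (M X <= M ((e |` X) `&` Y))%N.
  by apply: rk_mono => x Xx; split; [right | exact: XY].
have : (M Y <= M (e |` Y))%N by apply: rk_mono => x; right.
lia.
Qed.

(** By [rk_finitary] a finite subset of the closure already has its full rank, and its points can be
    added to [X] one at a time without raising the rank. *)
Lemma rk_cl X : M (cl M X) = M X.
Proof.
apply/eqP; rewrite eqn_leq; apply/andP; split; last first.
  by apply: rk_mono => x Xx; rewrite /cl /= setU1_absorb.
have [Y [/finite_fsetP[A ->] Acl <-]] := rk_finitary M (cl M X).
suff <- : M ([set x | x \in (A : seq E)] `|` X) = M X.
  by apply: rk_mono => x Ax; left.
elim: (A : seq E) (Acl : forall x, x \in (A : seq E) -> cl M X x) => [|a s IH] sX.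
  by rewrite (_ : _ `|` X = X) //; apply/seteqP; split=> x; [case|right].
have <- : a |` ([set x | x \in s] `|` X) = [set x | x \in a :: s] `|` X.
  rewrite setUA; congr (_ `|` X); apply/seteqP; split=> x /=.
    by case=> [->|xs]; rewrite inE ?eqxx ?xs ?orbT.
  by rewrite inE => /orP[/eqP ->|]; [left|right].
have aX : M (a |` X) = M X by apply: sX; rewrite inE eqxx.
rewrite (@rkU1_mono X _ a _ aX); last by move=> x; right.
by apply: IH => x xs; apply: sX; rewrite inE xs orbT.
Qed.

Lemma subset_cl X : X `<=` cl M X.
Proof. by move=> x Xx; rewrite /cl /= setU1_absorb. Qed.

Lemma cl_flat X : is_flat M (cl M X).
Proof.
apply/seteqP; split; last exact: subset_cl.
move=> e /= eX; apply/eqP; rewrite eqn_leq; apply/andP; split.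
  have /(rk_mono M) : e |` X `<=` e |` cl M X.
    by apply: setUS; exact: subset_cl.
  by rewrite eX rk_cl.
by apply: rk_mono => x; right.
Qed.

Lemma cl_sub_flat X F : is_flat M F -> X `<=` F -> cl M X `<=` F.
Proof. by move=> flF XF e eX; rewrite -flF; exact: rkU1_mono XF eX. Qed.

Lemma flatI F G : is_flat M F -> is_flat M G -> is_flat M (F `&` G).
Proof.
move=> flF flG; apply/seteqP; split; last exact: subset_cl.
by rewrite subsetI; split; apply: cl_sub_flat => // x [].
Qed.

Lemma flatT : is_flat M [set: E].
Proof. by apply/seteqP; split=> // x _; exact: subset_cl. Qed.

Lemma flat_rkU1 F e : is_flat M F -> ~ F e -> M (e |` F) = (M F).+1.
Proof.
move=> flF Fe; have := rkU1 F e.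
have : M (e |` F) <> M F by move=> eF; apply: Fe; rewrite -flF.
have : (M F <= M (e |` F))%N by apply: rk_mono => x; right.
lia.
Qed.

Lemma flat_sub_rk F X : is_flat M F -> F `<=` X -> (M X <= M F)%N -> X `<=` F.
Proof.
move=> flF FX XF e Xe; apply: contrapT => /(flat_rkU1 flF) eF.
have : (M (e |` F) <= M X)%N by apply: rk_mono => x [->|/FX].
lia.
Qed.

(** Take [H] of maximal rank among the flats containing [G] and missing [f]. If [H] were not a
    hyperplane, some [x] would lie outside the closure of [H] and [f]; by exchange the closure of
    [H] and [x] would still miss [f], against maximality. *)
Lemma hyperplane_avoiding G f : is_flat M G -> ~ G f ->
  exists H, [/\ is_hyperplane M H, G `<=` H & ~ H f].
Proof.
move=> flG Gf.
have [H [flH GH Hf] Hmax] := @exists_max_bounded _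
  (fun H => [/\ is_flat M H, G `<=` H & ~ H f]) M (M setT)
  (ex_intro _ G (And3 flG (@subset_refl _ G) Gf)) (fun H _ => rk_mono M (@subsetT _ H)).
exists H; split=> //; split=> //.
have ltHT : (M H < M setT)%N by rewrite -(flat_rkU1 flH Hf); exact: rk_mono.
apply/eqP; rewrite eqn_leq ltHT /= leqNgt; apply/negP => HT.
have fH := flat_rkU1 flH Hf.
have [x /= xfH] : exists x, ~ cl M (f |` H) x.
  apply/existsNP => all; have := rk_cl (f |` H).
  have -> : cl M (f |` H) = setT by apply/seteqP; split.
  lia.
have Hx : ~ H x by move=> Hx; apply: xfH; apply: subset_cl; right.
have /Hmax : [/\ is_flat M (cl M (x |` H)), G `<=` cl M (x |` H) & ~ cl M (x |` H) f].
  split; first exact: cl_flat.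
    by apply: subset_trans (@subset_cl _) => y /GH; right.
  by move=> fxH; apply: xfH; rewrite /cl /= setUCA fxH (flat_rkU1 flH Hx) fH.
by rewrite rk_cl (flat_rkU1 flH Hx) ltnn.
Qed.

End Flats.

(** * Modular cuts above [L] with a smallest member through each outside point *)

Section CutExtension.
Set Implicit Arguments.
Unset Strict Implicit.
Variables (E : choiceType) (M : matroid E) (C : set (set E)) (L : set E) (m : nat).
Hypothesis cutC : is_modular_cut M C.
Hypothesis CT : C setT.
Hypothesis notCL : ~ C L.
Hypothesis cut_above : forall G, C G -> L `<=` G.
Hypothesis cut_base : forall e, ~ L e ->
  exists2 F, C F /\ F e & forall G, C G -> G e -> F `<=` G.
Hypothesis cut_rk_ge : forall G, C G -> (m <= M G)%N.
Hypothesis ltLm : (M L < m)%N.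

Lemma cut_cl_setU G X : C G -> C (cl M (X `|` G)).
Proof.
have [Cflat Cup _] := cutC; move=> CG; apply: Cup CG (cl_flat _ _) _.
by apply: subset_trans (@subset_cl _ _ _) => x; right.
Qed.

(** The smallest member of [C] through a common point outside [L] lies in both sets, and [C] is
    closed upwards. *)
Lemma cut_setI G1 G2 : C G1 -> C G2 -> C (G1 `&` G2) \/ G1 `&` G2 `<=` L.
Proof.
have [Cflat Cup _] := cutC; move=> C1 C2.
have [|/existsNP[e /not_implyP[[e1 e2] Le]]] := pselect (G1 `&` G2 `<=` L); first by right.
left; have [F [CF _] Fmin] := cut_base Le.
apply: Cup CF (flatI (Cflat _ C1) (Cflat _ C2)) _.
by rewrite subsetI; split; exact: Fmin.
Qed.

(* The submodularity of the extension rests on this bound: it pays for pairs G1, G2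
   with G1 & G2 = L, where the extension rank of the intersection is at most m - 1. *)
Lemma cut_defect G1 G2 : C G1 -> C G2 ->
  (M (G1 `|` G2) + m <= (M G1 + M G2).+1)%N.
Proof.
move=> C1 C2; have [Cflat _ _] := cutC.
have [e e2 Le] : exists2 e, G2 e & ~ L e.
  apply: contrapT => no; apply: notCL; rewrite (_ : L = G2) //.
  apply/seteqP; split; first exact: cut_above.
  by move=> e e2; apply: contrapT => Le; apply: no; exists e.
have [F [CF Fe] Fmin] := cut_base Le.
have F2 : F `<=` G2 := Fmin _ C2 e2.
(* The closure of [G1] and [e] is a member of [C] through [e], so it contains [F]: joining all of
   [F] to [G1] costs no more than joining [e]. *)
have FG1 : (M (G1 `|` F) <= (M G1).+1)%N.
  apply: leq_trans (rkU1 M G1 e); rewrite -(rk_cl M (e |` G1)); apply: rk_mono.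
  move=> x [G1x|]; first by apply: subset_cl; right.
  by apply: Fmin; [exact: cut_cl_setU | apply: subset_cl; left].
have := rk_submod M (G1 `|` F) G2.
rewrite -setUA (proj2 (setUidPr _ _) F2).
have : (M F <= M ((G1 `|` F) `&` G2))%N.
  by apply: rk_mono => x Fx; split; [right | exact: F2].
have := cut_rk_ge CF; lia.
Qed.

Definition cut_rk_at X n := `[< exists2 G, C G /\ X `<=` G & M G = n >].

Lemma cut_rk_ex X : exists n, cut_rk_at X n.
Proof. by exists (M setT); apply/asboolP; exists setT. Qed.

Definition cut_rk X := ex_minn (cut_rk_ex X).

Lemma cut_rkP X : exists G, [/\ C G, X `<=` G & M G = cut_rk X].
Proof.
rewrite /cut_rk; case: ex_minnP => n /asboolP[G [CG XG] <-] _.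
by exists G.
Qed.

Lemma cut_rk_le G X : C G -> X `<=` G -> (cut_rk X <= M G)%N.
Proof.
move=> CG XG; rewrite /cut_rk; case: ex_minnP => n _; apply.
by apply/asboolP; exists G.
Qed.

Lemma cut_rk_cut G : C G -> cut_rk G = M G.
Proof.
move=> CG; apply/eqP; rewrite eqn_leq cut_rk_le //=.
by have [G' [_ GG' <-]] := cut_rkP G; exact: rk_mono.
Qed.

Lemma rk_le_cut_rk X : (M X <= cut_rk X)%N.
Proof. by have [G [_ XG <-]] := cut_rkP X; exact: rk_mono. Qed.

Lemma cut_rk_mono X Y : X `<=` Y -> (cut_rk X <= cut_rk Y)%N.
Proof.
by move=> XY; have [G [CG YG <-]] := cut_rkP Y; apply: cut_rk_le => // x /XY/YG.
Qed.

Lemma cut_rk_ge_min X : (m <= cut_rk X)%N.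
Proof. by have [G [CG _ <-]] := cut_rkP X; exact: cut_rk_ge. Qed.

Lemma cut_rk_setU G X : C G -> (cut_rk (G `|` X) <= M (G `|` X))%N.
Proof.
move=> CG; rewrite -(rk_cl M (G `|` X)); apply: cut_rk_le (@subset_cl _ _ _).
by rewrite setUC; exact: cut_cl_setU.
Qed.

(** * The extension by several points at once *)

Definition new_points := (m.-1 - M L)%N.
Local Notation d := new_points.

Definition new_card (Z : set (E + 'I_d)) : nat :=
  #|[pred i : 'I_d | `[< Z (inr i) >]]|.

(** If [Z] has old part [X] and just one new point, this is the rank in the single-element extension
    by [C]: [M X] if [cl M X] is in [C], and [M X + 1] otherwise. *)
Definition ext_rk (Z : set (E + 'I_d)) : nat :=
  minn (M (inl @^-1` Z) + new_card Z) (cut_rk (inl @^-1` Z)).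

Lemma new_cardUI Z1 Z2 :
  (new_card (Z1 `|` Z2) + new_card (Z1 `&` Z2) = new_card Z1 + new_card Z2)%N.
Proof.
rewrite /new_card -[RHS]cardUI; congr (_ + _)%N; apply: eq_card => i; rewrite !inE.
  exact: asbool_or.
exact: asbool_and.
Qed.

Lemma new_card_mono Z1 Z2 : Z1 `<=` Z2 -> (new_card Z1 <= new_card Z2)%N.
Proof.
move=> Z12; apply: subset_leq_card; apply/fintype.subsetP => i.
by rewrite !unfold_in /= => /asboolP Z1i; apply/asboolP; exact: Z12.
Qed.

Lemma ext_rk_mono Z1 Z2 : Z1 `<=` Z2 -> (ext_rk Z1 <= ext_rk Z2)%N.
Proof.
move=> Z12; have Z12l : inl @^-1` Z1 `<=` inl @^-1` Z2 by move=> x; exact: Z12.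
have := rk_mono M Z12l; have := cut_rk_mono Z12l; have := new_card_mono Z12.
rewrite /ext_rk; lia.
Qed.

(** The cases are which term attains each minimum. Where it is [cut_rk], the old part is replaced by
    a member of [C] of that rank, and submodularity of [M] is applied to the enlarged sets. *)
Lemma ext_rk_submod Z1 Z2 :
  (ext_rk (Z1 `|` Z2) + ext_rk (Z1 `&` Z2) <= ext_rk Z1 + ext_rk Z2)%N.
Proof.
wlog le12 : Z1 Z2 / (M (inl @^-1` Z1) + new_card Z1 < cut_rk (inl @^-1` Z1) ->
    M (inl @^-1` Z2) + new_card Z2 < cut_rk (inl @^-1` Z2))%N.
  move=> wl; case: (ltnP (M (inl @^-1` Z2) + new_card Z2) (cut_rk (inl @^-1` Z2))).
    by move=> ?; exact: wl.
  by move=> ge; rewrite setUC setIC [X in (_ <= X)%N]addnC; apply: wl; lia.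
have := new_cardUI Z1 Z2.
have : (new_card (Z1 `&` Z2) <= new_card Z2)%N.
  by apply: new_card_mono => x [].
have : (new_card (Z1 `&` Z2) <= d)%N by rewrite -[X in (_ <= X)%N]card_ord; exact: max_card.
rewrite /ext_rk preimage_setU preimage_setI /new_points.
move: le12; move: (inl @^-1` Z1) (inl @^-1` Z2) => X Y.
move: (new_card Z1) (new_card Z2) (new_card (Z1 `&` Z2)) (new_card (Z1 `|` Z2)) => c1 c2 cI cU le12 cId cI2 cE.
have sub := rk_submod M X Y.
case: (ltnP (M X + c1)%N (cut_rk X)) => [/le12|le1]; first by lia.
have [G1 [CG1 XG1 <-]] := cut_rkP X.
case: (ltnP (M Y + c2)%N (cut_rk Y)) => [_|le2].
  have := rk_submod M G1 Y.
  have : (cut_rk (X `|` Y) <= M (G1 `|` Y))%N.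
    by apply: leq_trans (cut_rk_setU Y CG1); apply: cut_rk_mono; exact: setSU.
  have : (M (X `&` Y) <= M (G1 `&` Y))%N by apply: rk_mono; exact: setSI.
  lia.
have [G2 [CG2 YG2 <-]] := cut_rkP Y.
have : (cut_rk (X `|` Y) <= M (G1 `|` G2))%N.
  by apply: leq_trans (cut_rk_setU G2 CG1); apply: cut_rk_mono; exact: setUSS.
have := rk_submod M G1 G2.
have := cut_defect CG1 CG2.
have XYI : X `&` Y `<=` G1 `&` G2 by exact: setISS.
(* If the meet is in [C], its rank bounds [cut_rk] of the intersection. Otherwise the intersection
   has extension rank at most [M L + d = m - 1], and [cut_defect] makes up the difference. *)
have [CI|IL] := cut_setI CG1 CG2.
  by have := cut_rk_le CI XYI; lia.
have : (M (X `&` Y) <= M L)%N by apply: rk_mono; exact: subset_trans IL.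
lia.
Qed.

Lemma new_card0 Z : (forall i, ~ Z (inr i)) -> new_card Z = 0%N.
Proof. by move=> Z0; apply: eq_card0 => i; rewrite !unfold_in /=; exact/asboolP. Qed.

Lemma new_cardT Z : (forall i, Z (inr i)) -> new_card Z = d.
Proof.
move=> ZT; rewrite /new_card -[RHS]card_ord; apply: eq_card => i.
by rewrite !unfold_in /=; apply/asboolP.
Qed.

Lemma ext_rk_inl X : ext_rk (inl @` X) = M X.
Proof.
rewrite /ext_rk (_ : _ @^-1` _ = X); last first.
  by apply/seteqP; split=> x /=; [case=> y Xy [<-] | exists x].
rewrite new_card0 ?addn0; last by move=> i [].
exact/minn_idPl/rk_le_cut_rk.
Qed.

Lemma ext_rkU1 z Z : (ext_rk (z |` Z) <= (ext_rk Z).+1)%N.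
Proof.
have := ext_rk_submod [set z] Z.
suff : (ext_rk [set z] <= 1)%N by lia.
case: z => [e|i].
  by rewrite -image_set1 ext_rk_inl -[[set e]]setU0 -(rk0 M); exact: rkU1.
rewrite /ext_rk geq_min; apply/orP; left.
rewrite (_ : _ @^-1` _ = set0); last by apply/seteqP; split.
rewrite rk0 add0n /new_card (@fintype.eq_card1 _ i) // => j.
by rewrite !unfold_in /=; apply/asboolP/eqP => [[]|->].
Qed.

Lemma ext_rk_le_card (A : {fset E + 'I_d}) : (ext_rk [set` A] <= #|` A|)%N.
Proof.
suff sizeP (s : seq (E + 'I_d)) : (ext_rk [set x | x \in s] <= size s)%N.
  exact: sizeP.
elim: s => [|a s IH].
  rewrite (_ : [set x | x \in [::]] = inl @` set0); first by rewrite ext_rk_inl rk0.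
  by rewrite image_set0; apply/seteqP; split.
apply: leq_trans (leq_trans (ext_rkU1 a [set x | x \in s]) _) => //.
by apply: ext_rk_mono => x /=; rewrite inE => /orP[/eqP ->|]; [left|right].
Qed.

(** A finite subset spanning the old part suffices, together with the finitely many new points of
    [Z]. Both terms of the minimum are preserved: a member of [C] is a flat, so if it contains the
    finite subset it contains the whole old part. *)
Lemma ext_rk_finitary Z :
  exists Y, [/\ finite_set Y, Y `<=` Z & ext_rk Y = ext_rk Z].
Proof.
have [Y [finY YZ rkY]] := rk_finitary M (inl @^-1` Z).
exists ((inl @` Y) `|` [set z | Z z /\ exists i, z = inr i]).
have Yl : inl @^-1` ((inl @` Y) `|` [set z | Z z /\ exists i, z = inr i]) = Y.
  apply/seteqP; split=> x /=; last by left; exists x.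
  by case=> [[y Yy [<-]] //|[_ [i]]].
have cardY : new_card ((inl @` Y) `|` [set z | Z z /\ exists i, z = inr i]) = new_card Z.
  apply: eq_card => i; rewrite !unfold_in /=; apply: asbool_equiv_eq; split.
    by case=> [[]|[]].
  by move=> Zi; right; split=> //; exists i.
split.
- rewrite finite_setU; split; first exact: finite_image.
  apply: (@sub_finite_set _ _ (inr @` [set: 'I_d])); last exact/finite_image/finite_finset.
  by move=> z [_ [i ->]]; exists i.
- by move=> z [[y /YZ Zy <-]|[]].
rewrite /ext_rk Yl cardY rkY; congr minn; apply/eqP; rewrite eqn_leq cut_rk_mono //=.
have [G [CG YG <-]] := cut_rkP Y; apply: cut_rk_le => //.
have [Cflat _ _] := cutC.
apply: subset_trans (cl_sub_flat (Cflat _ CG) YG).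
apply: subset_trans (@subset_cl _ M _) _.
apply: flat_sub_rk; [exact: cl_flat| |by rewrite !rk_cl rkY].
by apply: cl_sub_flat; [exact: cl_flat | exact: subset_trans YZ (@subset_cl _ _ _)].
Qed.

Definition cut_extension : matroid (E + 'I_d)%type :=
  Matroid ext_rk_le_card ext_rk_mono ext_rk_submod ext_rk_finitary.

Lemma cut_extensionP : is_extension M cut_extension inl.
Proof. by split; [move=> x y [] | exact: ext_rk_inl]. Qed.

Lemma ext_rk_inlU X : ext_rk (inl @` X `|` range inr) = minn (M X + d) (cut_rk X).
Proof.
rewrite /ext_rk (_ : _ @^-1` _ = X); last first.
  by apply/seteqP; split=> x /=; [case=> -[y Xy // [<-]] | left; exists x].
by rewrite new_cardT // => i; right; exists i.
Qed.

Lemma ext_rk_inlU_cut G : C G -> ext_rk (inl @` G `|` range inr) = M G.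
Proof. by move=> CG; rewrite ext_rk_inlU cut_rk_cut //; apply/minn_idPr/leq_addr. Qed.

(** Adding all new points to [G] leaves its rank at [M G], so they lie in the closure; old points
    outside [G] do not, because [G] is a flat of [M]. *)
Lemma cl_cut_extension G : C G ->
  cl cut_extension (inl @` G) = inl @` G `|` range inr.
Proof.
move=> CG; have [Cflat _ _] := cutC.
have eqMG Z : inl @` G `<=` Z -> Z `<=` inl @` G `|` range inr -> ext_rk Z = M G.
  move=> /ext_rk_mono + /ext_rk_mono; rewrite ext_rk_inl ext_rk_inlU_cut //; lia.
apply/seteqP; split=> [[e|i]|z GPz]; rewrite /cl /= ?ext_rk_inl.
- rewrite -image_set1 -image_setU ext_rk_inl => eG; left; exists e => //.
  by rewrite -(Cflat _ CG).
- by right; exists i.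
- by apply: eqMG => [x|x [->|]]; [right | | left].
Qed.

(** The union of the closures has rank [M H + 1] and their intersection, [L] with all new points,
    has rank [m - 1]; the sum is [m + M H]. *)
Lemma modular_pair_cut_extension F H :
  C F -> M F = m -> C H -> is_hyperplane M H -> ~ F `<=` H -> F `&` H = L ->
  modular_pair cut_extension (cl cut_extension (inl @` F)) (cl cut_extension (inl @` H)).
Proof.
move=> CF rkF CH [flH rkH] /existsNP[e /not_implyP[Fe He]] FHL.
rewrite !cl_cut_extension // /modular_pair /= !ext_rk_inlU_cut //.
rewrite -setUUl -setUIl -image_setU (_ : _ `&` _ = inl @` (F `&` H)); last first.
  apply/seteqP; split=> [z [[x Fx <-] [y Hy [yx]]]|z [x [Fx Hx] <-]].
    by exists x; rewrite // -yx in Fx *.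
  by split; exists x.
have -> : ext_rk (inl @` (F `|` H) `|` range inr) = M setT.
  rewrite ext_rk_inlU.
  have := cut_rk_setU H CF; have := rk_le_cut_rk (F `|` H).
  have := rk_mono M (@subsetT _ (F `|` H)).
  have : (M (e |` H) <= M (F `|` H))%N by apply: rk_mono => x [->|]; [left | right].
  have := flat_rkU1 flH He; lia.
(* As [M L < m], the truncated subtraction is exact and [M L + d = m - 1], which is below
   [cut_rk L]. *)
rewrite FHL ext_rk_inlU /new_points; have := cut_rk_ge_min L; lia.
Qed.

End CutExtension.

(** * Choice of the cut and of the pair *)

Theorem theorem7 (E : choiceType) (M : matroid E) (hM : ~ OTE M) :
  exists F H : set E,
    [/\ is_flat M F, is_hyperplane M H, ~ modular_pair M F H
      & exists (E' : choiceType) (N : matroid E') (i : E -> E'),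
          [/\ is_extension M N i,
              finite_set [set: E] -> finite_set [set: E']
            & modular_pair N (cl N (i @` F)) (cl N (i @` H))]].
Proof.
move/existsNP: (hM) => [C0 /not_implyP[[C0flat C0up C0mod] /not_implyP[[G0 C0G0] nprinC0]]].
have C0T : C0 setT by apply: C0up C0G0 (flatT M) _.
pose above L := C0 `&` [set G | L `<=` G].
have [L [flL nprinL] Lmax] : exists2 L,
    is_flat M L /\ ~ is_principal M (above L) &
    forall L', is_flat M L' /\ ~ is_principal M (above L') -> (M L' <= M L)%N.
  apply: (exists_max_bounded _ M (M setT)); last by move=> L _; exact: rk_mono.
  (* Every flat contains the closure of the empty set, so restricting to flats above it gives back
     [C0]. *)
  exists (cl M set0); split; first exact: cl_flat.
  rewrite (_ : above _ = C0) //; apply/seteqP; split=> [G []|G CG] //; split=> //.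
  by apply: cl_sub_flat; [exact: C0flat | exact: sub0set].
pose C := above L.
have cutC : is_modular_cut M C.
  split=> [F []|F G [C0F LF] flG FG|F G [C0F LF] [C0G LG] FGmod]; first by move/C0flat.
    by split; [exact: C0up C0F flG FG | exact: subset_trans FG].
  by split; [exact: C0mod | rewrite /= subsetI].
have CT : C setT by split.
have notCL : ~ C L.
  move=> [C0L _]; apply: nprinL; exists L => //; apply/seteqP; split=> G [].
    by move=> /C0flat.
  by move=> flG LG; split=> //; exact: C0up C0L flG LG.
have cut_above G : C G -> L `<=` G by case.
have cut_base e : ~ L e ->
    exists2 F, C F /\ F e & forall G, C G -> G e -> F `<=` G.
  move=> Le; pose L' := cl M (e |` L).
  have eL' : e |` L `<=` L' by exact: subset_cl.
  (* [L'] has larger rank than [L], so maximality applies. The generator of [above L'] is the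
     required smallest member, since every member of [C] through [e] contains [L']. *)
  have : is_principal M (above L').
    apply: contrapT => nprin; have := Lmax L' (conj (cl_flat M _) nprin).
    by rewrite /L' rk_cl (flat_rkU1 flL Le) ltnn.
  case=> F flF aboveE.
  have [C0F L'F] : above L' F by rewrite aboveE; split.
  exists F => [|G [C0G LG] Ge].
    split; last by apply: L'F; apply: eL'; left.
    by split=> // x Lx; apply: L'F; apply: eL'; right.
  have : above L' G.
    by split=> //; apply: cl_sub_flat; [exact: C0flat | move=> x [->|/LG]].
  by rewrite aboveE => -[].
have [Cflat Cup Cmod] := cutC.
have [F CF Fmin] : exists2 F, C F & forall G, C G -> (M F <= M G)%N.
  have [|G _|F CF Fmax] := exists_max_bounded C (fun G => M setT - M G)%N (M setT).
  - by exists setT.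
  - exact: leq_subr.
  exists F => // G CG; have := Fmax _ CG.
  have := rk_mono M (@subsetT _ G); have := rk_mono M (@subsetT _ F); lia.
have ltLF : (M L < M F)%N.
  rewrite ltnNge; apply/negP => FL; apply: notCL.
  suff -> : L = F by [].
  apply/seteqP; split; first exact: cut_above.
  by apply: flat_sub_rk FL => //; exact: cut_above.
(* Otherwise [F] would generate [C]. *)
have [G CG /existsNP[f /not_implyP[Ff Gf]]] : exists2 G, C G & ~ F `<=` G.
  apply: contrapT => all; apply: nprinL; exists F; first exact: Cflat.
  apply/seteqP; split=> G; last by case=> flG FG; exact: Cup CF flG FG.
  move=> CG; split; first exact: Cflat.
  by apply: contrapT => nFG; apply: all; exists G.
have [H [hypH GH Hf]] := hyperplane_avoiding (Cflat _ CG) Gf.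
have CH : C H by case: hypH => flH _; exact: Cup CG flH GH.
have FHL : F `&` H = L.
  apply/seteqP; split=> [e [Fe He]|e Le]; last by split; apply: cut_above Le.
  (* [B] lies in both [F] and [H]. Minimality of the rank of [F] forces [B = F], so [f] would be in
     [H]. *)
  apply: contrapT => Le; have [B [CB _] Bmin] := cut_base e Le.
  have BF := Bmin _ CF Fe; apply: Hf; apply: (Bmin _ CH He).
  exact: flat_sub_rk (Cflat _ CB) BF (Fmin _ CB) _ Ff.
have nFH : ~ F `<=` H by move=> /(_ f Ff).
exists F, H; split=> //; first exact: Cflat.
  (* Modularity in [M] would put [L] in [C]. *)
  by move=> /(Cmod _ _ CF CH); rewrite FHL.
exists (E + 'I_(new_points M L (M F)))%type.
exists (cut_extension cutC CT notCL cut_above cut_base Fmin ltLF), inl.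
split; first exact: cut_extensionP.
- move=> finE; apply: (@sub_finite_set _ _ (range inl `|` range inr)).
    by move=> [x|x] _; [left | right]; exists x.
  by rewrite finite_setU; split; apply: finite_image => //; exact: finite_finset.
- exact: modular_pair_cut_extension.
Qed.
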